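(* Let $p(t)=\sum_{i=0}^\infty a_it^i$ with $0\le a_i<1$ for all $i$ and $\sum_i a_i=1$, and write $p(t)=t^rp_0(t)$ where $r\ge0$ is an integer, $p_0(0)\neq0$, and $p_0$ has at least two nonzero coefficients; let $Q=\{q\ge0:\ \text{the coefficient of } t^q \text{ in } p_0 \text{ is nonzero}\}$. Let $p^{[1]}=p$, $p^{[n+1]}=p(p^{[n]})$, $p^{[n]}(t)=\sum_k a_k^{[n]}t^k$, and $a=\lim_{n\to\infty}a_0^{[n]}$. Fix $m\in\mathbb N$, let $C_m$ be the cyclic group of order $m$ generated by $\bar t$ with identity $e=\bar t^0$, and for a power series $f(t)=\sum_kf_kt^k$ with absolutely summable coefficients put $f(\bar t)=\sum_kf_k\bar t^k\in R[C_m]$. Let $G_{p_0}$ be the subgroup of $C_m$ generated by $\{\bar t^q: q\in Q\}$ and $c_{p_0}=\frac1{|G_{p_0}|}\sum_{g\in G_{p_0}}g$. Let $d\ge1$ and distinct $m_0,\dots,m_{d-1}\in\{0,\dots,m-1\}$ be such that $r^{kd+i}\equiv m_i \pmod m$ for all $i\in\{0,\dots,d-1\}$ and all sufficiently large $k$. Then: (1) If $\bigcap_{i=0}^{d-1}\bar t^{m_i}G_{p_0}=\emptyset$, then $\lim_{n\to\infty}p^{[n]}(\bar t)$ does not exist. (2) If $\bigcap_{i=0}^{d-1}\bar t^{m_i}G_{p_0}\neq\emptyset$, then $\bar t^{m_i}G_{p_0}=\bar t^{m_j}G_{p_0}$ for all $i,j\in\{0,\dots,d-1\}$, the limit $\lim_{n\to\infty}p^{[n]}(\bar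 t)$ exists, and $$\lim_{n\to\infty}p^{[n]}(\bar t)=\bar t^{m_0}c_{p_0}+(e-c_{p_0})a.$$
   Context: $R[C_m]$ is the real group algebra of $C_m$ (equivalently $\mathbb R[t]/(t^m-1)$ with $\bar t$ the class of $t$), with the Euclidean topology. The limit $a=\lim a_0^{[n]}$ exists since $(a_0^{[n]})$ is monotone and bounded. The sequence $(r^k \bmod m)_k$ is eventually periodic, which guarantees the existence of $d$ and $m_0,\dots,m_{d-1}$ as described. *)

(* Defs.v *)
From HB Require Import structures.
From mathcomp Require Import all_boot all_order all_algebra.
From mathcomp Require Import all_classical all_reals all_analysis.
Set Implicit Arguments. Unset Strict Implicit. Unset Printing Implicit Defensive.
Import Order.TTheory GRing.Theory Num.Theory.
Import numFieldNormedType.Exports.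
Local Open Scope ring_scope.

Section Defs.
Variable R : realType.

Fixpoint powc (f : nat -> R) (i : nat) (k : nat) : R :=
  match i with
  | 0 => (k == 0%N)%:R
  | i'.+1 => \sum_(j < k.+1) f j * powc f i' (k - j)
  end.

Definition comp (a f : nat -> R) (k : nat) : R :=
  limn (fun N => \sum_(0 <= i < N) a i * powc f i k).

(* iterc a n = coefficients of p^{[n+1]} : p^{[1]} = p, p^{[n+1]} = p(p^{[n]}) *)
Fixpoint iterc (a : nat -> R) (n : nat) : nat -> R :=
  match n with
  | 0 => a
  | n'.+1 => comp a (iterc a n')
  end.

Definition alim (a : nat -> R) : R := limn (fun n => iterc a n 0%N).

(* The group algebra R[C_m]: an element sum_{j<m} x_j tbar^j is the row
   vector x with x 0 j = x_j (Euclidean topology of 'rV[R]_m). *)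
Definition evalC (m : nat) (f : nat -> R) : 'rV[R]_m :=
  \row_(j < m) limn (fun N => \sum_(0 <= k < N) (if (k %% m)%N == j then f k else 0)).

Definition tpow (m i : nat) : 'rV[R]_m := \row_(j < m) (((i %% m)%N == j)%:R).

Definition eC (m : nat) : 'rV[R]_m := tpow m 0.

Definition gmul (m : nat) (x y : 'rV[R]_m) : 'rV[R]_m :=
  \row_(k < m) \sum_(i < m) \sum_(j < m)
     ((((i + j) %% m)%N == k)%:R * x 0 i * y 0 j).

End Defs.

(* Subsets of C_m are represented by predicates on exponents j < m
   (tbar^j <-> j). *)
Definition is_subgroupC (m : nat) (S : nat -> Prop) : Prop :=
  [/\ forall j, S j -> (j < m)%N,
      S 0%N,
      forall x y, S x -> S y -> S ((x + y) %% m)%N &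
      forall x, S x -> S ((m - x) %% m)%N].

Definition genC (m : nat) (A : nat -> Prop) (j : nat) : Prop :=
  (j < m)%N /\ forall S, is_subgroupC m S -> (forall x, A x -> S (x %% m)%N) -> S j.

Definition cosetC (m i : nat) (G : nat -> Prop) (j : nat) : Prop :=
  exists g, G g /\ j = ((i + g) %% m)%N.

(* Q = {q : coefficient of t^q in p_0 nonzero}, p = t^r p_0 *)
Definition Qset (R : realType) (a : nat -> R) (r : nat) (q : nat) : Prop :=
  a (r + q)%N != 0.

Definition Gp0 (R : realType) (m : nat) (a : nat -> R) (r : nat) : nat -> Prop :=
  genC m (Qset a r).

Definition cC (R : realType) (m : nat) (G : nat -> Prop) : 'rV[R]_m :=
  \row_(j < m) (if `[< G j >] then (#|[set i : 'I_m | `[< G i >]]|%:R)^-1 else 0).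

(* Main.v *)
(** Send [t] to the cyclic translation matrix [T]; then [p^[n]] evaluated at [tbar]
    becomes the [n]-th iterate of [X |-> p(X)] at [T].  Let [C] be the averaging
    matrix over [G_{p_0}], an idempotent commuting with [T].
    On the range of [C] one has [p^[n](T) C = T^(r^n) C] exactly, because every
    exponent of [p] is congruent to [r] modulo [G_{p_0}]; this part is
    eventually periodic and decides whether the limit exists.  On the range of
    [1 - C], the random walk driven by [X = p(T)] satisfies a Doeblin condition
    ([0] lies in [Q], so all elements of [G_{p_0}] are reached in one common
    number of steps), whence [|X^k (1 - C)| <= K s^k] for some [s < 1].  As
    [p^[n+1](T) = p^[n](X)], the distance from [p^[n+1](T) (1 - C)] to
    [a_0^[n] (1 - C)] is at most [K (p^[n](s) - p^[n](0))].  This tends to [0]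
    by convexity of [p] on [0, 1]. *)

Require Import Defs.
From HB Require Import structures.
From mathcomp Require Import all_boot all_order all_algebra.
From mathcomp Require Import all_classical all_reals all_analysis.
From mathcomp Require Import ring lra.
Import Order.TTheory GRing.Theory Num.Theory.
Import numFieldNormedType.Exports.
Local Open Scope classical_set_scope.
Local Open Scope ring_scope.

(** * Series with nonnegative terms and functions of substochastic matrices *)

Section RealSeries.
Set Implicit Arguments.
Unset Strict Implicit.
Context {R : realType}.
Implicit Types (b : nat -> R) (f g : nat -> R).

Lemma nneg_series_nondecreasing b : (forall k, 0 <= b k) ->
  {homo series b : N M / (N <= M)%N >-> N <= M}.
Proof. by move=> b0; apply/nondecreasing_series => k _ _; exact: b0. Qed.

Lemma nneg_series_cvg b (M : R) : (forall k, 0 <= b k) ->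
  (forall N, series b N <= M) -> series b @ \oo --> limn (series b).
Proof.
move=> b0 bM; apply: nondecreasing_is_cvgn.
  exact: nneg_series_nondecreasing.
by exists M => _ [N _ <-]; exact: bM.
Qed.

Lemma cvgn_le_bound (u : nat -> R) (l M : R) :
  u @ \oo --> l -> (forall N, u N <= M) -> l <= M.
Proof.
by move=> ul uM; apply: (ler_cvg_to ul (cvg_cst M)); near=> N; exact: uM.
Unshelve. all: by end_near. Qed.

Lemma nneg_series_le b (l : R) : (forall k, 0 <= b k) ->
  series b @ \oo --> l -> forall N, series b N <= l.
Proof.
move=> b0 bl N; rewrite -(cvg_lim _ bl)//.
apply: nondecreasing_cvgn_le; first exact: nneg_series_nondecreasing.
by apply/cvg_ex; exists l.
Qed.

Lemma nneg_series_ge0 b (l : R) : (forall k, 0 <= b k) ->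
  series b @ \oo --> l -> 0 <= l.
Proof.
by move=> b0 /(nneg_series_le b0)/(_ 0%N); rewrite /series /= big_geq.
Qed.

Lemma cvgn_sum (I : Type) (s : seq I) (P : pred I) (F : I -> nat -> R) (l : I -> R) :
  (forall i, F i @ \oo --> l i) ->
  (fun N => \sum_(i <- s | P i) F i N) @ \oo --> \sum_(i <- s | P i) l i.
Proof.
move=> Fl; elim: s => [|i s IHs].
  rewrite big_nil; apply: cvg_near_cst; apply: nearW => N; exact: big_nil.
rewrite big_cons; under eq_fun do rewrite big_cons.
by case: (P i) => //; apply: cvgD.
Qed.

(** Each partial sum of [c] is a limit of finite rectangular sums, and by nonnegativity each
    rectangle is at most a partial sum of [r]. *)
Lemma series_exchange_le (b : nat -> nat -> R) (r c : nat -> R) (S : R) :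
  (forall i k, 0 <= b i k) ->
  (forall i, series (b i) @ \oo --> r i) ->
  (forall k, series (fun i => b i k) @ \oo --> c k) ->
  (forall N, series r N <= S) -> forall K, series c K <= S.
Proof.
move=> b0 br bc rS K.
have cK : (fun N => \sum_(0 <= k < K) series (fun i => b i k) N) @ \oo
    --> series c K by apply: cvgn_sum.
apply: (cvgn_le_bound cK) => N; apply: le_trans (rS N).
rewrite /series /= exchange_big_nat /=.
by apply: ler_sum => i _; exact: (nneg_series_le (b0 i)).
Qed.

(** Tonelli for double series: the one-sided bound is applied to the array and to its transpose. *)
Lemma series_exchange (b : nat -> nat -> R) (r c : nat -> R) (S : R) :
  (forall i k, 0 <= b i k) ->
  (forall i, series (b i) @ \oo --> r i) ->
  (forall k, series (fun i => b i k) @ \oo --> c k) ->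
  series r @ \oo --> S -> series c @ \oo --> S.
Proof.
move=> b0 br bc rS.
have r0 i : 0 <= r i.
  exact: nneg_series_ge0 (b0 i) (br i).
have c0 k : 0 <= c k.
  exact: nneg_series_ge0 (fun i => b0 i k) (bc k).
have cS : forall K, series c K <= S.
  by apply: (series_exchange_le b0 br bc); exact: nneg_series_le.
have cl := nneg_series_cvg c0 cS.
suff -> : S = limn (series c) by [].
apply/eqP; rewrite eq_le (cvgn_le_bound cl)// andbT.
apply: (cvgn_le_bound rS).
apply: (series_exchange_le (fun k i => b0 i k) bc br).
exact: nneg_series_le.
Qed.

Definition subprob f := (forall k, 0 <= f k) /\ forall N, series f N <= 1.

Lemma subprob_le1 {f} (k : nat) : subprob f -> f k <= 1.
Proof.
move=> [f0 f1]; apply: le_trans (f1 k.+1).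
by rewrite /series /= big_nat_recr//= lerDr sumr_ge0.
Qed.

Definition conv f g k : R := \sum_(j < k.+1) f j * g (k - j)%N.

End RealSeries.

Section Substochastic.
Set Implicit Arguments.
Unset Strict Implicit.
Context {R : realType} {n : nat}.
Implicit Types (f g : nat -> R) (X Y B : 'M[R]_n.+1).

Definition substoch X := (forall i j, 0 <= X i j) /\ forall i, \sum_j X i j <= 1.

Lemma substoch_le1 X i j : substoch X -> X i j <= 1.
Proof.
move=> [X0 X1]; apply: le_trans (X1 i); rewrite (bigD1 j)//= lerDl.
by apply: sumr_ge0.
Qed.

Lemma substochM X Y : substoch X -> substoch Y -> substoch (X * Y).
Proof.
move=> [X0 X1] [Y0 Y1]; split=> [i j|i].
  by rewrite mxE sumr_ge0// => l _; rewrite mulr_ge0.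
under eq_bigr do rewrite mxE.
rewrite exchange_big/=; apply: le_trans (X1 i); apply: ler_sum => l _.
by rewrite -mulr_sumr ler_piMr.
Qed.

Lemma substoch1 : substoch (1 : 'M[R]_n.+1).
Proof.
split=> [i j|i]; first by rewrite mxE ler0n.
rewrite (bigD1 i)//= mxE eqxx big1 ?addr0// => j /negPf ji.
by rewrite mxE eq_sym ji.
Qed.

Lemma substochX X k : substoch X -> substoch (X ^+ k).
Proof.
move=> sX; elim: k => [|k IHk]; first by rewrite expr0; exact: substoch1.
by rewrite exprS; exact: substochM.
Qed.

(** The matrix [f(X)], summed entrywise. *)
Definition gfun f X : 'M[R]_n.+1 :=
  \matrix_(i, j) limn (series (fun k => f k * (X ^+ k) i j)).

Lemma gfun_cvg f X i j : subprob f -> substoch X ->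
  series (fun k => f k * (X ^+ k) i j) @ \oo --> gfun f X i j.
Proof.
move=> [f0 f1] sX; rewrite mxE; apply: (@nneg_series_cvg _ _ 1) => [k|N].
  by rewrite mulr_ge0//; have [] := substochX k sX.
apply: le_trans (f1 N); apply: ler_sum => k _.
by rewrite ler_piMr// substoch_le1//; exact: substochX.
Qed.

Lemma gfun_unique f X (L : 'M[R]_n.+1) :
  (forall i j, series (fun k => f k * (X ^+ k) i j) @ \oo --> L i j) ->
  gfun f X = L.
Proof. by move=> fL; apply/matrixP => i j; rewrite mxE; apply: cvg_lim. Qed.

Lemma gfun_substoch f X : subprob f -> substoch X -> substoch (gfun f X).
Proof.
move=> sf sX; have [f0 f1] := sf; split=> [i j|i].
  apply: nneg_series_ge0 (gfun_cvg sf sX) => k.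
  by rewrite mulr_ge0//; have [] := substochX k sX.
have sE : (fun N => \sum_j series (fun k => f k * (X ^+ k) i j) N) @ \oo -->
    \sum_j gfun f X i j by apply: cvgn_sum => j; exact: gfun_cvg.
apply: (cvgn_le_bound sE) => N; apply: le_trans (f1 N).
rewrite /series /= exchange_big/=; apply: ler_sum => k _.
by rewrite -mulr_sumr ler_piMr//; have [] := substochX k sX.
Qed.

Lemma gfun_mulr_cvg f X B i j : subprob f -> substoch X ->
  series (fun k => f k * (X ^+ k * B) i j) @ \oo --> (gfun f X * B) i j.
Proof.
move=> sf sX; rewrite mxE.
have sE : (fun N => \sum_l series (fun k => f k * (X ^+ k) i l) N * B l j) @ \oo
    --> \sum_l gfun f X i l * B l j.
  by apply: cvgn_sum => l; apply: cvgMr_tmp; exact: gfun_cvg.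
rewrite (_ : series _ = fun N =>
  \sum_l series (fun k => f k * (X ^+ k) i l) N * B l j)//.
apply/funext => N; under [RHS]eq_bigr do rewrite /series /= mulr_suml.
rewrite exchange_big/=; apply: eq_bigr => k _; rewrite mxE mulr_sumr.
by apply: eq_bigr => l _; rewrite mulrA.
Qed.

Lemma gfun_mull_cvg f X B i j : subprob f -> substoch X ->
  series (fun k => f k * (B * X ^+ k) i j) @ \oo --> (B * gfun f X) i j.
Proof.
move=> sf sX; rewrite mxE.
have sE : (fun N => \sum_l B i l * series (fun k => f k * (X ^+ k) l j) N) @ \oo
    --> \sum_l B i l * gfun f X l j.
  by apply: cvgn_sum => l; apply: cvgMl_tmp; exact: gfun_cvg.
rewrite (_ : series _ = fun N =>
  \sum_l B i l * series (fun k => f k * (X ^+ k) l j) N)//.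
apply/funext => N; under [RHS]eq_bigr do rewrite /series /= mulr_sumr.
rewrite exchange_big/=; apply: eq_bigr => k _; rewrite mxE mulr_sumr.
by apply: eq_bigr => l _; rewrite mulrCA.
Qed.

(** Cauchy product, by Tonelli on the triangular array indexed by the exponent [p] taken from [f]
    and the total exponent [q]. *)
Lemma gfun_conv_cvg f g X i j : subprob f -> subprob g -> substoch X ->
  series (fun k => conv f g k * (X ^+ k) i j) @ \oo -->
    (gfun f X * gfun g X) i j.
Proof.
move=> sf sg sX.
pose b p q := if (p <= q)%N then f p * g (q - p)%N * (X ^+ q) i j else 0.
apply: (@series_exchange _ b (fun p => f p * (X ^+ p * gfun g X) i j)).
- move=> p q; rewrite /b; case: ifP => // _.
  by rewrite !mulr_ge0//; [case: sf|case: sg|have [] := substochX q sX].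
(* Row [p] vanishes before column [p]; shifted by [p], it is [f p] times the series for
   [X^p g(X)]. *)
- move=> p; rewrite -(cvg_shiftn p).
  rewrite (_ : (fun N => _) = fun N => f p *
     series (fun q => g q * (X ^+ p * X ^+ q) i j) N).
    by apply: cvgMl_tmp; exact: gfun_mull_cvg.
  apply/funext => N; rewrite /series /= (big_cat_nat (leq0n p) (leq_addl N p))/=.
  rewrite big1_seq ?add0r; last first.
    move=> q; rewrite mem_index_iota /= /b => qp.
    by rewrite leqNgt qp.
  rewrite -{1}(add0n p) big_addn addnK mulr_sumr; apply: eq_bigr => q _.
  by rewrite /b leq_addl addnK (addnC q) exprD mulrA.
- move=> q; apply: cvg_near_cst; exists q.+1 => // N /= qN.
  rewrite /series /= (big_cat_nat (leq0n q.+1) qN)/=.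
  rewrite [X in _ + X]big1_seq ?addr0; last first.
    by move=> p; rewrite mem_index_iota /= /b => /andP[qp _]; rewrite leqNgt qp.
  rewrite /conv mulr_suml big_mkord; apply: eq_bigr => p _.
  by rewrite /b -ltnS ltn_ord.
- exact: gfun_mulr_cvg.
Qed.

Lemma gfun_conv f g X : subprob f -> subprob g -> substoch X ->
  gfun (conv f g) X = gfun f X * gfun g X.
Proof.
by move=> sf sg sX; apply: gfun_unique => i j; exact: gfun_conv_cvg.
Qed.

End Substochastic.

(** * Composition of generating functions *)

Section Composition.
Set Implicit Arguments.
Unset Strict Implicit.
Context {R : realType}.
Implicit Types (a f g : nat -> R).

Lemma subprob_cvg f (l : R) : (forall k, 0 <= f k) ->
  series f @ \oo --> l -> l <= 1 -> subprob f.
Proof. by move=> f0 fl l1; split=> // N; apply: le_trans l1; exact: nneg_series_le. Qed.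

Lemma subprob_conv f g : subprob f -> subprob g -> subprob (conv f g).
Proof.
(* The total mass is read off at the 1-by-1 identity matrix, as the entry of a product of
   substochastic matrices. *)
move=> sf sg; have s1 := @substoch1 R 0.
have := @gfun_conv_cvg R 0 f g 1 ord0 ord0 sf sg s1.
under [X in series X]eq_fun do rewrite expr1n mxE eqxx mulr1.
move/subprob_cvg; apply.
  by move=> k; apply: sumr_ge0 => j _; rewrite mulr_ge0//; [case: sf|case: sg].
by apply: substoch_le1; apply: substochM; exact: gfun_substoch.
Qed.

Lemma subprob_powc f i : subprob f -> subprob (powc f i).
Proof.
move=> sf; elim: i => [|i IHi]; last exact: subprob_conv.
split=> [k|[|N]]; first exact: ler0n.
  by rewrite /series /= big_geq.
by rewrite /series /= big_nat_recl//= big1 ?addr0.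
Qed.

Lemma gfun_powc n f (X : 'M[R]_n.+1) i : subprob f -> substoch X ->
  gfun (powc f i) X = gfun f X ^+ i.
Proof.
move=> sf sX; elim: i => [|i IHi]; last first.
  by rewrite exprS -IHi -gfun_conv//; exact: subprob_powc.
apply: gfun_unique => u v; apply: cvg_near_cst; exists 1%N => // -[//|N] _.
by rewrite /series /= big_nat_recl//= mul1r big1 ?addr0// => k _; rewrite mul0r.
Qed.

Lemma comp_cvg a f k : subprob a -> subprob f ->
  series (fun i => a i * powc f i k) @ \oo --> Defs.comp a f k.
Proof.
move=> [a0 a1] sf; apply: (@nneg_series_cvg _ _ 1) => [i|N].
  by rewrite mulr_ge0//; have [] := subprob_powc i sf.
apply: le_trans (a1 N); apply: ler_sum => i _.
by rewrite ler_piMr// subprob_le1//; exact: subprob_powc.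
Qed.

Lemma comp_ge0 a f k : subprob a -> subprob f -> 0 <= Defs.comp a f k.
Proof.
move=> sa sf; apply: nneg_series_ge0 (comp_cvg sa sf) => i.
by rewrite mulr_ge0//; [case: sa|have [] := subprob_powc i sf].
Qed.

(** Tonelli on the array [a i * powc f i k * (X ^+ k) u v]: summing over [k] first gives [a i] times
    an entry of [f(X)^i], summing over [i] first gives the coefficients of the composite. *)
Lemma gfun_comp_cvg n a f (X : 'M[R]_n.+1) u v :
  subprob a -> subprob f -> substoch X ->
  series (fun k => Defs.comp a f k * (X ^+ k) u v) @ \oo -->
    gfun a (gfun f X) u v.
Proof.
move=> sa sf sX.
apply: (@series_exchange _ (fun i k => a i * (powc f i k * (X ^+ k) u v))
  (fun i => a i * (gfun f X ^+ i) u v)).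
- move=> i k; rewrite !mulr_ge0//; first by case: sa.
    by have [] := subprob_powc i sf.
  by have [] := substochX k sX.
- move=> i; rewrite -gfun_powc//.
  rewrite (_ : series _ = fun N =>
      a i * series (fun k => powc f i k * (X ^+ k) u v) N).
    by apply: cvgMl_tmp; apply: gfun_cvg => //; exact: subprob_powc.
  by apply/funext => N; rewrite /series /= mulr_sumr.
- move=> k; rewrite (_ : series _ = fun N =>
      series (fun i => a i * powc f i k) N * (X ^+ k) u v).
    by apply: cvgMr_tmp; exact: comp_cvg.
  by apply/funext => N; rewrite /series /= mulr_suml; under eq_bigr do rewrite mulrA.
- by apply: gfun_cvg => //; exact: gfun_substoch.
Qed.

Lemma subprob_comp a f : subprob a -> subprob f -> subprob (Defs.comp a f).
Proof.
move=> sa sf; have s1 := @substoch1 R 0.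
have := @gfun_comp_cvg 0 a f 1 ord0 ord0 sa sf s1.
under [X in series X]eq_fun do rewrite expr1n mxE eqxx mulr1.
move/subprob_cvg; apply; first by move=> k; exact: comp_ge0.
by apply: substoch_le1; do 2!apply: gfun_substoch => //.
Qed.

Lemma gfun_comp n a f (X : 'M[R]_n.+1) : subprob a -> subprob f -> substoch X ->
  gfun (Defs.comp a f) X = gfun a (gfun f X).
Proof. by move=> sa sf sX; apply: gfun_unique => u v; exact: gfun_comp_cvg. Qed.

Lemma gfun_comm n f (X B : 'M[R]_n.+1) : subprob f -> substoch X ->
  GRing.comm B X -> GRing.comm B (gfun f X).
Proof.
move=> sf sX BX; apply/matrixP => i j.
have /cvg_lim <- // := @gfun_mull_cvg R n f X B i j sf sX.
have /cvg_lim <- // := @gfun_mulr_cvg R n f X B i j sf sX.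
by congr (limn (series _)); apply/funext => k; rewrite (commrX k BX).
Qed.

Lemma subprob_iterc a n : subprob a -> subprob (iterc a n).
Proof. by move=> sa; elim: n => //= n IHn; exact: subprob_comp. Qed.

Lemma gfun_iterc n a k (X : 'M[R]_n.+1) : subprob a -> substoch X ->
  gfun (iterc a k) X = iter k.+1 (gfun a) X.
Proof.
move=> sa sX; elim: k => //= k IHk.
by rewrite gfun_comp ?IHk//; exact: subprob_iterc.
Qed.

(** Peels off the innermost [p], whereas [iterc] unfolds the outermost; decay of the powers of
    [p(T)] can then control all later iterates. *)
Lemma gfun_itercSr n a k (X : 'M[R]_n.+1) : subprob a -> substoch X ->
  gfun (iterc a k.+1) X = gfun (iterc a k) (gfun a X).
Proof.
by move=> sa sX; rewrite !gfun_iterc ?iterSr//; exact: gfun_substoch.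
Qed.

Definition pgf f (s : R) : R := limn (series (fun k => f k * s ^+ k)).

Lemma substoch_scalar (s : R) : 0 <= s <= 1 -> substoch (s%:M : 'M[R]_1).
Proof.
move=> /andP[s0 s1]; split=> [i j|i]; rewrite ?big_ord1 !mxE ?ord1 ?eqxx//.
Qed.

Lemma gfun_scalar f (s : R) : gfun f (s%:M : 'M[R]_1) = (pgf f s)%:M.
Proof.
rewrite [LHS]mx11_scalar mxE; congr (_%:M); congr (limn (series _)).
apply/funext => k; congr (_ * _).
have -> : (s%:M ^+ k : 'M[R]_1) = (s ^+ k)%:M by rewrite -rmorphXn.
by rewrite mxE eqxx.
Qed.

Lemma pgf_cvg f s : subprob f -> 0 <= s <= 1 ->
  series (fun k => f k * s ^+ k) @ \oo --> pgf f s.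
Proof.
move=> [f0 f1] /andP[s0 s1]; apply: (@nneg_series_cvg _ _ 1) => [k|N].
  by rewrite mulr_ge0// exprn_ge0.
apply: le_trans (f1 N); apply: ler_sum => k _.
by rewrite ler_piMr// exprn_ile1.
Qed.

Lemma pgf_bounds f s : subprob f -> 0 <= s <= 1 -> 0 <= pgf f s <= 1.
Proof.
move=> sf hs; have sE := gfun_substoch sf (substoch_scalar hs).
have := sE.1 0 0; have := substoch_le1 0 0 sE.
by rewrite gfun_scalar mxE eqxx => -> ->.
Qed.

Lemma pgf0 f : pgf f 0 = f 0%N.
Proof.
apply: cvg_lim => //; apply: cvg_near_cst; exists 1%N => // -[//|N] _.
rewrite /series /= big_nat_recl//= expr0 mulr1 big1 ?addr0// => k _.
by rewrite expr0n mulr0.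
Qed.

Lemma pgf_iterc a k s : subprob a -> 0 <= s <= 1 ->
  pgf (iterc a k) s = iter k.+1 (pgf a) s.
Proof.
move=> sa hs.
have iterE j : iter j (gfun a) (s%:M : 'M[R]_1) = (iter j (pgf a) s)%:M.
  by elim: j => //= j ->; exact: gfun_scalar.
have := gfun_iterc k sa (substoch_scalar hs).
by rewrite gfun_scalar iterE => /matrixP/(_ 0 0); rewrite !mxE eqxx.
Qed.

Lemma iter_pgf_bounds a k s : subprob a -> 0 <= s <= 1 ->
  0 <= iter k (pgf a) s <= 1.
Proof. by move=> sa hs; elim: k => //= k; exact: pgf_bounds. Qed.

Lemma le_pgf f s t : subprob f -> 0 <= s -> s <= t -> t <= 1 -> pgf f s <= pgf f t.
Proof.
move=> sf s0 st t1; have t0 := le_trans s0 st; have s1 := le_trans st t1.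
have hs : 0 <= s <= 1 by rewrite s0.
have ht : 0 <= t <= 1 by rewrite t0.
apply: (ler_cvg_to (pgf_cvg sf hs) (pgf_cvg sf ht)).
apply: nearW => N; apply: ler_sum => k _; have [f0 _] := sf.
by apply: ler_wpM2l => //; rewrite lerXn2r.
Qed.

Lemma le_iter_pgf a k s t : subprob a -> 0 <= s -> s <= t -> t <= 1 ->
  iter k (pgf a) s <= iter k (pgf a) t.
Proof.
move=> sa s0 st t1; elim: k => //= k IHk.
have /andP[? _] : 0 <= iter k (pgf a) s <= 1.
  by apply: iter_pgf_bounds; rewrite // s0 (le_trans st).
have /andP[_ ?] : 0 <= iter k (pgf a) t <= 1.
  by apply: iter_pgf_bounds; rewrite // t1 (le_trans s0).
exact: le_pgf.
Qed.

(** Since [0 <= pgf a 0] and [pgf a] is monotone, its iterates from 0 increase. *)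
Lemma iterc0_nondecreasing a : subprob a ->
  {homo (fun n => iterc a n 0%N) : n m / (n <= m)%N >-> n <= m}.
Proof.
move=> sa; apply/nondecreasing_seqP => k.
rewrite -!pgf0 !pgf_iterc// ?lexx ?ler01// [leRHS]iterSr.
have /andP[? ?] : 0 <= pgf a 0 <= 1 by rewrite pgf_bounds// lexx ler01.
exact: le_iter_pgf.
Qed.

Lemma alim_cvg a : subprob a -> (fun n => iterc a n 0%N) @ \oo --> alim a.
Proof.
move=> sa; apply: nondecreasing_is_cvgn; first exact: iterc0_nondecreasing.
by exists 1 => _ [k _ <-]; apply: subprob_le1; exact: subprob_iterc.
Qed.

End Composition.

(** * Iterates on the unit interval *)

Section Extinction.
Set Implicit Arguments.
Unset Strict Implicit.
Context {R : realType}.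
Implicit Types (a : nat -> R) (s h : R).

(** Induction from the square, where equality holds. Divided by [(s - h) * (1 - h)], this is
    quantitative convexity: the slope of the power over [[h, s]] is below its slope over [[h, 1]] by
    at least [1 - s]. *)
Lemma exprn_chord_gap s h k : 0 <= h -> h <= s -> s <= 1 ->
  (s ^+ k.+2 - h ^+ k.+2) * (1 - h) + (s - h) * (1 - h) * (1 - s)
    <= (s - h) * (1 - h ^+ k.+2).
Proof.
move=> h0 hs s1; have h1 := le_trans hs s1; have s0 := le_trans h0 hs.
elim: k => [|k IHk]; first by rewrite le_eqVlt; apply/orP; left; apply/eqP; ring.
set p := h ^+ k.+2 in IHk *; set q := s ^+ k.+2 in IHk *.
rewrite !(exprS _ k.+2) -/p -/q.
have ph : p <= h by rewrite /p exprS ler_piMr// exprn_ile1.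
have := ler_wpM2l s0 IHk; have : 0 <= (s - h) * (1 - s) * (h - p).
  by rewrite !mulr_ge0 ?subr_ge0.
have : 0 <= (s - h) * (1 - s) * (1 - h) * s by rewrite !mulr_ge0 ?subr_ge0.
by lra.
Qed.

Lemma exprn_chord s h k : 0 <= h -> h <= s -> s <= 1 ->
  (s ^+ k - h ^+ k) * (1 - h) <= (s - h) * (1 - h ^+ k).
Proof.
move=> h0 hs s1; case: k => [|[|k]]; rewrite ?expr0 ?expr1 ?subrr ?mul0r ?mulr0//.
apply: le_trans (exprn_chord_gap k h0 hs s1); rewrite lerDl.
by rewrite !mulr_ge0 ?subr_ge0// (le_trans hs).
Qed.

(** Averages the chord inequalities of the powers with weights [a], of total mass 1, and retains the
    convexity gap of the single exponent [k.+2]. *)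
Lemma pgf_chord a s h k : subprob a -> series a @ \oo --> (1 : R) ->
  0 <= h -> h <= s -> s <= 1 ->
  (pgf a s - pgf a h) * (1 - h) + a k.+2 * ((s - h) * (1 - h) * (1 - s))
    <= (s - h) * (1 - pgf a h).
Proof.
move=> sa suma h0 hs s1; have h1 := le_trans hs s1; have s0 := le_trans h0 hs.
have Ps : series (fun k => a k * s ^+ k) @ \oo --> pgf a s.
  by apply: pgf_cvg; rewrite ?s0.
have Ph : series (fun k => a k * h ^+ k) @ \oo --> pgf a h.
  by apply: pgf_cvg; rewrite ?h0.
(* [b] collects the termwise slacks of the chord inequality; their sum is at least the term
   [k.+2]. *)
pose b k := a k * ((s - h) * (1 - h ^+ k) - (s ^+ k - h ^+ k) * (1 - h)).
have b0 j : 0 <= b j.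
  by apply: mulr_ge0; [case: sa|rewrite subr_ge0 exprn_chord].
have bl : series b @ \oo -->
    (s - h) * (1 - pgf a h) - (pgf a s - pgf a h) * (1 - h).
  have -> : series b = fun N => (s - h) * (series a N - series (fun k => a k * h ^+ k) N)
      - (series (fun k => a k * s ^+ k) N - series (fun k => a k * h ^+ k) N) * (1 - h).
    apply/funext => N; rewrite /series /= -!sumrB mulr_sumr mulr_suml -sumrB.
    by apply: eq_bigr => j _; rewrite /b; ring.
  apply: cvgB; first by apply: cvgMl_tmp; exact: cvgB.
  by apply: cvgMr_tmp; exact: cvgB.
have := nneg_series_le b0 bl k.+3.
rewrite {1}/series /= big_nat_recr//= => /(le_trans _) lb.
have : b k.+2 <= (s - h) * (1 - pgf a h) - (pgf a s - pgf a h) * (1 - h).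
  by apply: lb; rewrite lerDr sumr_ge0.
move=> bk; have := exprn_chord_gap k h0 hs s1; rewrite -lerBrDl => gap.
rewrite -lerBrDl; apply: le_trans bk.
by rewrite /b ler_wpM2l//; case: sa.
Qed.

Lemma pgf_affine a s h : subprob a -> (forall k, a k.+2 = 0) ->
  0 <= h <= 1 -> 0 <= s <= 1 -> pgf a s - pgf a h = a 1%N * (s - h).
Proof.
move=> sa a0 hh hs.
have pgfE t : pgf a t = a 0%N + a 1%N * t.
  apply: cvg_lim => //; apply: cvg_near_cst; exists 2%N => // -[|[|N]]// _.
  rewrite /series /= !big_nat_recl//= big1 ?addr0 ?mulr1// => k _.
  by rewrite a0 mul0r.
by rewrite !pgfE; ring.
Qed.

Lemma iter_pgf_gap_affine a s : subprob a -> a 1%N < 1 ->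
  (forall k, a k.+2 = 0) -> 0 <= s <= 1 ->
  (fun n => iter n (pgf a) s - iter n (pgf a) 0) @ \oo --> (0 : R).
Proof.
move=> sa a1 a0 hs.
have -> : (fun n => iter n (pgf a) s - iter n (pgf a) 0) = geometric s (a 1%N).
  apply/funext => n /=; elim: n => [|n IHn]; first by rewrite expr0 mulr1 subr0.
  rewrite !iterS pgf_affine ?iter_pgf_bounds ?lexx ?ler01// IHn exprS; ring.
by apply: cvg_geometric; rewrite ger0_norm//; case: sa.
Qed.

(* With [h < s] the images of [0] and [s] under the [n]-th iterate of the convex
   function [pgf a], the ratio [(s - h) / (1 - h)] decreases geometrically as
   long as [h] stays away from [1]. *)
Lemma iter_pgf_gap_supercritical a s k (A : R) :
  subprob a -> series a @ \oo --> (1 : R) ->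
  0 < a k.+2 -> (forall n, iter n (pgf a) 0 <= A) -> A < 1 -> 0 <= s -> s < 1 ->
  (fun n => iter n (pgf a) s - iter n (pgf a) 0) @ \oo --> (0 : R).
Proof.
move=> sa suma ak hA A1 s0 s1.
have A0 : 0 <= A by exact: (hA 0%N).
have hh n : 0 <= iter n (pgf a) 0 <= 1 by apply: iter_pgf_bounds; rewrite ?lexx ?ler01.
have hs n : 0 <= iter n (pgf a) s <= 1 by apply: iter_pgf_bounds; rewrite ?s0 ?ltW.
have le_hs n : iter n (pgf a) 0 <= iter n (pgf a) s.
  by apply: le_iter_pgf; rewrite // ltW.
(* With [g] an iterate of [s], [tau] will bound [1 - g] from below, and [kap] is the resulting
   contraction factor of [(g - h) / (1 - h)]. *)
pose tau := (1 - A) * (1 - s); pose kap := 1 - a k.+2 * tau * (1 - A).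
have tau0 : 0 < tau by rewrite mulr_gt0 ?subr_gt0.
have tau1 : tau <= 1 by rewrite mulr_ile1 ?subr_ge0 ?(ltW A1) ?(ltW s1) ?gerBl.
have gap0 : 0 < a k.+2 * tau * (1 - A) by rewrite !mulr_gt0 ?subr_gt0.
have gap1 : a k.+2 * tau * (1 - A) <= 1.
  have ? := ltW tau0; have ? := ltW ak; have ? := ltW A1.
  apply: mulr_ile1; [by rewrite mulr_ge0 | by rewrite subr_ge0 | | by rewrite gerBl].
  by apply: mulr_ile1 => //; exact: subprob_le1.
have kap0 : 0 <= kap by rewrite subr_ge0.
have kap1 : kap < 1 by rewrite gtrBl.
have main n : iter n (pgf a) s - iter n (pgf a) 0
    <= kap ^+ n * s * (1 - iter n (pgf a) 0).
  elim: n => [|n IHn]; first by rewrite /= expr0 mul1r !subr0 mulr1.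
  have /andP[h0 h1] := hh n; have /andP[_ g1] := hs n.
  have /andP[h'0 h'1] := hh n.+1; have := le_hs n; have := hA n; have := le_hs n.+1.
  have := pgf_chord k sa suma h0 (le_hs n) g1.
  rewrite -!iterS; set h := iter n _ 0 in IHn h0 h1 *.
  set g := iter n _ s in IHn g1 *; set h' := iter n.+1 _ 0 in h'0 h'1 *.
  set g' := iter n.+1 _ s => chord hg' hlA hg.
  have lt1h : 0 < 1 - h by rewrite subr_gt0 (le_lt_trans hlA).
  have kn1 : kap ^+ n <= 1 by rewrite exprn_ile1// ltW.
  (* [1 - g = (1 - h) - (g - h)], and the induction hypothesis gives [g - h <= s * (1 - h)]. *)
  have g_tau : tau <= 1 - g.
    have : kap ^+ n * s * (1 - h) <= s * (1 - h).
      by rewrite -mulrA ler_piMl// mulr_ge0// ltW.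
    have : tau <= (1 - h) * (1 - s).
      by rewrite ler_pM2r ?subr_gt0// lerD2l lerN2.
    by lra.
  rewrite -(ler_pM2r lt1h).
  have e1 : a k.+2 * ((g - h) * (1 - h) * tau) <= a k.+2 * ((g - h) * (1 - h) * (1 - g)).
    by rewrite ler_pM2l// ler_wpM2l// mulr_ge0 ?subr_ge0.
  (* [(1 - A) * (1 - h') <= 1 - h] turns the gap into a multiple of [1 - h']. *)
  have e2 : a k.+2 * ((g - h) * ((1 - A) * (1 - h')) * tau)
      <= a k.+2 * ((g - h) * (1 - h) * tau).
    rewrite ler_pM2l// ler_pM2r// ler_wpM2l ?subr_ge0//.
    apply: (@le_trans _ _ (1 - A)); last by rewrite lerD2l lerN2.
    by apply: ler_piMr; [rewrite subr_ge0 ltW | rewrite gerBl].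
  have e3 : (g - h) * ((1 - h') * kap) <= kap ^+ n * s * (1 - h) * ((1 - h') * kap).
    by rewrite ler_wpM2r// mulr_ge0 ?subr_ge0.
  rewrite exprS; rewrite /kap in e3 *; set K := _ ^+ n in e3 *.
  by lra.
have kn0 : (fun n => kap ^+ n) @ \oo --> (0 : R).
  have -> : (fun n => kap ^+ n) = geometric 1 kap.
    by apply/funext => n /=; rewrite mul1r.
  by apply: cvg_geometric; rewrite ger0_norm.
apply: (squeeze_cvgr _ (cvg_cst (0 : R)) kn0); apply: nearW => n.
rewrite subr_ge0 le_hs/=; apply: le_trans (main n) _.
have /andP[h0 h1] := hh n.
rewrite -mulrA ler_piMr ?exprn_ge0//.
by rewrite mulr_ile1 ?subr_ge0 ?(ltW s1) ?gerBl.
Qed.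

Lemma iter_pgf_gap a s : subprob a -> series a @ \oo --> (1 : R) ->
  a 1%N < 1 -> 0 <= s -> s < 1 ->
  (fun n => pgf (iterc a n) s - iterc a n 0%N) @ \oo --> (0 : R).
Proof.
move=> sa suma a1 s0 s1; have s01 : 0 <= s <= 1 by rewrite s0 ltW.
have alE n : iterc a n 0%N = iter n.+1 (pgf a) 0.
  by rewrite -pgf0 pgf_iterc// lexx ler01.
have acvg := alim_cvg sa.
have le_al n : iterc a n 0%N <= alim a.
  by apply: (nondecreasing_cvgn_le (iterc0_nondecreasing sa)); exact: acvg.
suff : (fun n => iter n (pgf a) s - iter n (pgf a) 0) @ \oo --> (0 : R).
  rewrite -cvg_shiftS; under eq_fun do rewrite -pgf_iterc// -alE.
  exact.
(* Three cases: limit below 1 with a coefficient of degree at least 2, limit below 1 with [p]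
   affine, and limit 1, where the iterates of [s] are squeezed between those of 0 and 1. *)
have [a_lt1|a_ge1] := ltP (alim a) 1.
  have [[k ak]|no] := pselect (exists k, a k.+2 != 0).
    apply: (@iter_pgf_gap_supercritical _ _ k (alim a)) => //.
      by rewrite lt_def ak sa.1.
    move=> [|n]; last by rewrite -alE.
    by apply: le_trans (le_al 0%N); exact: sa.1.
  apply: iter_pgf_gap_affine => // k; apply/eqP/negPn/negP => ak.
  by apply: no; exists k.
rewrite -cvg_shiftS.
have c0 : (fun n => 1 - iterc a n 0%N) @ \oo --> (0 : R).
  have -> : (0 : R) = 1 - alim a.
    apply/eqP; rewrite eq_sym subr_eq0 eq_le a_ge1.
    rewrite (cvgn_le_bound acvg)// => n; apply: subprob_le1; exact: subprob_iterc.
  by apply: cvgB => //; exact: cvg_cst.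
apply: (squeeze_cvgr _ (cvg_cst (0 : R)) c0); apply: nearW => n.
rewrite alE subr_ge0 le_iter_pgf// ?lerD2r/=; last exact: ltW.
by have /andP[] := iter_pgf_bounds n.+1 sa s01.
Qed.

End Extinction.

(** * Geometric decay from a Doeblin condition *)

Section Decay.
Set Implicit Arguments.
Unset Strict Implicit.
Context {R : realType} {n : nat}.
Implicit Types (f : nat -> R) (X C W : 'M[R]_n.+1).

Lemma bernoulli_ineq (x : R) k : 0 <= x <= 1 -> 1 - k%:R * x <= (1 - x) ^+ k.
Proof.
move=> /andP[x0 x1]; elim: k => [|k IHk]; first by rewrite mul0r subr0 expr0.
rewrite exprS; have x1' : 0 <= 1 - x by rewrite subr_ge0.
have := ler_wpM2l x1' IHk; apply: le_trans.
have : 0 <= k%:R * (x * x) by rewrite !mulr_ge0.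
by rewrite -natr1; lra.
Qed.

Lemma substoch_sub_le1 X Y i j : substoch X -> substoch Y -> `|(X - Y) i j| <= 1.
Proof.
move=> sX sY; rewrite !mxE ler_norml.
have := substoch_le1 i j sX; have := substoch_le1 i j sY.
by have := sX.1 i j; have := sY.1 i j; lra.
Qed.

(** Write [X^N = eps X^N C + (1 - eps) Z] with [Z] substochastic. The first summand dies on [1 - C],
    so [X^(N k) (1 - C) = (1 - eps)^k Z^k (1 - C)]. *)
Lemma doeblin_decay X C (N : nat) (eps : R) : substoch X ->
  substoch C -> C * C = C -> X * C = C * X ->
  (forall i, \sum_j (X ^+ N * C) i j = 1) ->
  (0 < N)%N -> 0 < eps < 1 ->
  (forall i j, eps * (X ^+ N * C) i j <= (X ^+ N) i j) ->
  exists K s, [/\ 0 <= s, s < 1 &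
    forall k i j, `|(X ^+ k * (1 - C)) i j| <= K * s ^+ k].
Proof.
move=> sX sC CC XC sumXC N0 /andP[e0 e1] doeb; have e1' : 0 < 1 - eps by rewrite subr_gt0.
pose Z := (1 - eps)^-1 *: (X ^+ N - eps *: (X ^+ N * C)).
have sZ : substoch Z.
  split=> [i j|i].
    rewrite !mxE mulr_ge0 ?invr_ge0 ?(ltW e1')// subr_ge0.
    by have := doeb i j; rewrite !mxE.
  under eq_bigr do rewrite 4!mxE.
  rewrite -mulr_sumr sumrB -mulr_sumr sumXC mulr1.
  rewrite mulrC ler_pdivrMr// mul1r lerD2r.
  by have [] := substochX N sX.
have XNE : (X ^+ N) * (1 - C) = (1 - eps) *: Z * (1 - C).
  rewrite scalerA divff ?gt_eqF// scale1r mulrBl -[in RHS]scalerAl -mulrA.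
  by rewrite [C * _]mulrBr mulr1 CC subrr mulr0 scaler0 subr0.
have comXC : GRing.comm X (1 - C).
  by rewrite /GRing.comm mulrBl mulrBr mul1r mulr1 XC.
have comZ : GRing.comm (1 - C) ((1 - eps) *: Z).
  apply: commr_sym; rewrite /GRing.comm -XNE -(commrX N (commr_sym comXC)).
  rewrite scalerA divff ?gt_eqF// scale1r.
  rewrite mulrBr -[in RHS]scalerAr mulrA.
  have -> : (1 - C) * X ^+ N * C = 0.
    rewrite (commrX N (commr_sym comXC)) -mulrA mulrBl CC mul1r subrr.
    by rewrite mulr0.
  by rewrite scaler0 subr0.
have decayN k : X ^+ (N * k) * (1 - C) = ((1 - eps) *: Z) ^+ k * (1 - C).
  elim: k => [|k IHk]; first by rewrite muln0 !expr0.
  rewrite mulnS exprD -mulrA IHk exprS -[RHS]mulrA -(commrX k comZ).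
  by rewrite !mulrA XNE.
(* A substitute for the [N]-th root of [1 - eps]: Bernoulli gives [1 - eps <= s ^+ N]. *)
pose s := 1 - eps / N%:R.
have N0R : 0 < N%:R :> R by rewrite ltr0n.
have eN0 : 0 < eps / N%:R by rewrite divr_gt0.
have eN1 : eps / N%:R <= 1.
  by rewrite ler_pdivrMr// mul1r (le_trans (ltW e1))// ler1n.
have s0 : 0 <= s by rewrite subr_ge0.
have s1 : s < 1 by rewrite gtrBl.
have sN : 1 - eps <= s ^+ N.
  have := @bernoulli_ineq (eps / N%:R) N; rewrite ltW//= eN1 => /(_ isT).
  by rewrite mulrCA divff ?gt_eqF// mulr1.
(* The constant pays for the remainder of [k] modulo [N], since
   [s ^+ (k %% N) >= s ^+ N >= 1 - eps]. *)
exists (1 - eps)^-1, s; split=> // k i j.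
rewrite {1}(divn_eq k N) mulnC addnC exprD -mulrA decayN exprZn -scalerAl.
rewrite -scalerAr mulrA.
set W := X ^+ _ * Z ^+ _; have sW : substoch W by apply: substochM; exact: substochX.
rewrite mxE normrM ger0_norm ?exprn_ge0 ?(ltW e1')//.
apply: (@le_trans _ _ ((1 - eps) ^+ (k %/ N))).
  rewrite ler_piMr ?exprn_ge0 ?(ltW e1')//.
  (* [W (1 - C)] is a difference of two substochastic matrices. *)
  rewrite mulrBr mulr1; apply: substoch_sub_le1 => //; exact: substochM.
rewrite mulrC ler_pdivlMr// {2}(divn_eq k N) mulnC exprD exprM.
apply: ler_pM; rewrite ?exprn_ge0 ?(ltW e1')//.
  by rewrite lerXn2r// nnegrE ?exprn_ge0 ?(ltW e1').
apply: (le_trans sN); apply: ler_wiXn2l => //; first exact: ltW.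
by rewrite ltnW// ltn_mod.
Qed.

(** The term of index 0 is exactly [f 0 * D]; the term of index [k] is at most [K f_k s^k]. *)
Lemma gfun_decay f X D (K s : R) i j : subprob f -> substoch X ->
  0 <= s <= 1 -> (forall k, `|(X ^+ k * D) i j| <= K * s ^+ k) ->
  `|(gfun f X * D) i j - f 0%N * D i j| <= K * (pgf f s - f 0%N).
Proof.
move=> sf sX hs XK.
have cl : (fun N => `|series (fun k => f k * (X ^+ k * D) i j) N - f 0%N * D i j|)
    @ \oo --> `|(gfun f X * D) i j - f 0%N * D i j|.
  by apply: cvg_norm; apply: cvgB; [exact: gfun_mulr_cvg|exact: cvg_cst].
have cr : (fun N => K * (series (fun k => f k * s ^+ k) N - f 0%N)) @ \oo
    --> K * (pgf f s - f 0%N).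
  by apply: cvgMl_tmp; apply: cvgB; [exact: pgf_cvg|exact: cvg_cst].
apply: (ler_cvg_to cl cr); exists 1%N => // -[//|N] _ /=.
rewrite /series /= !big_nat_recl//= !expr0 mul1r mulr1 (addrC (f 0%N * D i j)).
rewrite addrK (addrC (f 0%N)) addrK mulr_sumr.
apply: le_trans (ler_norm_sum _ _ _) _; apply: ler_sum => k _.
rewrite normrM ger0_norm; last exact: sf.1.
by rewrite mulrCA ler_wpM2l//; exact: sf.1.
Qed.

End Decay.

(** * Translations of the cyclic group *)

Section Translations.
Set Implicit Arguments.
Unset Strict Implicit.
Context {R : realType} {n : nat}.
Local Notation I := 'I_n.+1.
Implicit Types (x y i j : I) (H : {set I}).

(** Multiplication by [tbar^x], acting on row vectors. *)
Definition transl x : 'M[R]_n.+1 := \matrix_(i, j) (j == i + x)%:R.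

Lemma transl_mulE x (B : 'M[R]_n.+1) i j : (transl x * B) i j = B (i + x) j.
Proof.
rewrite mxE (bigD1 (i + x))//= !mxE eqxx mul1r big1 ?addr0// => l /negPf lx.
by rewrite mxE lx mul0r.
Qed.

Lemma mul_translE x (B : 'M[R]_n.+1) i j : (B * transl x) i j = B i (j - x).
Proof.
rewrite mxE (bigD1 (j - x))//= !mxE subrK eqxx mulr1 big1 ?addr0// => l lj.
by rewrite mxE -subr_eq eq_sym (negPf lj) mulr0.
Qed.

Lemma translD x y : transl (x + y) = transl x * transl y.
Proof. by apply/matrixP => i j; rewrite transl_mulE !mxE addrA. Qed.

Lemma transl0 : transl 0 = 1.
Proof. by apply/matrixP => i j; rewrite !mxE addr0 eq_sym. Qed.

Lemma translX x k : transl x ^+ k = transl (x *+ k).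
Proof.
elim: k => [|k IHk]; first by rewrite expr0 mulr0n transl0.
by rewrite exprS IHk mulrS translD.
Qed.

Lemma inZp_mulrn k : (inZp 1 : I) *+ k = inZp k.
Proof. by rewrite Zp_mulrn; apply: val_inj; rewrite /= modnMml mul1n. Qed.

Lemma inZp_mul p q : (inZp (p * q) : I) = inZp q *+ p.
Proof. by rewrite -[LHS]inZp_mulrn mulnC mulrnA inZp_mulrn. Qed.

Lemma inZpD p q : (inZp (p + q) : I) = inZp p + inZp q.
Proof. by rewrite -inZp_mulrn mulrnDr !inZp_mulrn. Qed.

Lemma translZX k : transl (inZp 1) ^+ k = transl (inZp k).
Proof. by rewrite translX inZp_mulrn. Qed.

Lemma substoch_transl x : substoch (transl x).
Proof.
split=> [i j|i]; first by rewrite mxE ler0n.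
rewrite (bigD1 (i + x))//= mxE eqxx big1 ?addr0// => j /negPf jx.
by rewrite mxE jx.
Qed.

(** Multiplication by the uniform element of [H]; row 0 is [c_{p_0}] when [H] is [G_{p_0}]. *)
Definition avg H : 'M[R]_n.+1 :=
  \matrix_(i, j) (if j - i \in H then #|H|%:R^-1 else 0).

Definition zgroup H := 0 \in H /\ forall x y, x \in H -> y \in H -> x - y \in H.

Section Average.
Variables (H : {set I}) (gH : zgroup H).

Let H0 : 0 \in H := gH.1.
Let HB x y : x \in H -> y \in H -> x - y \in H := @gH.2 x y.

Lemma zgroupN x : x \in H -> - x \in H.
Proof. by move=> Hx; rewrite -sub0r HB. Qed.

Lemma zgroupD x y : x \in H -> y \in H -> x + y \in H.
Proof. by move=> Hx Hy; rewrite -(opprK y) HB ?zgroupN. Qed.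

Lemma zgroupMn x k : x \in H -> x *+ k \in H.
Proof. by move=> Hx; elim: k => [|k IHk]; rewrite ?mulr0n// mulrS zgroupD. Qed.

Lemma zgroup_addl x y : x \in H -> (x + y \in H) = (y \in H).
Proof.
move=> Hx; apply/idP/idP => [|Hy]; last exact: zgroupD.
by move=> /(HB)/(_ Hx); rewrite addrC addKr.
Qed.

Lemma card_zgroup_gt0 : 0 < #|H|%:R :> R.
Proof. by rewrite ltr0n; apply/card_gt0P; exists 0. Qed.

Lemma avg_sum i : \sum_j avg H i j = 1.
Proof.
rewrite (reindex_inj (addrI i))/=.
under eq_bigr do rewrite mxE addrC addKr.
rewrite -big_mkcond /= sumr_const -[X in X = _]mulr_natr mulVf//.
by rewrite gt_eqF// card_zgroup_gt0.
Qed.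

Lemma substoch_avg : substoch (avg H).
Proof.
split=> [i j|i]; last by rewrite avg_sum.
by rewrite mxE; case: ifP; rewrite // invr_ge0 ler0n.
Qed.

Lemma transl_avg_comm x : transl x * avg H = avg H * transl x.
Proof.
by apply/matrixP => i j; rewrite transl_mulE mul_translE !mxE opprD addrA addrAC.
Qed.

Lemma transl_avg x : x \in H -> transl x * avg H = avg H.
Proof.
move=> Hx; apply/matrixP => i j; rewrite transl_mulE !mxE opprD.
by rewrite (addrC (- i)) addrCA (@zgroup_addl (- x)) ?zgroupN.
Qed.

Lemma transl_avg_eq x y : x - y \in H -> transl x * avg H = transl y * avg H.
Proof.
by move=> Hxy; rewrite -{1}(subrK y x) translD -mulrA transl_avg_comm mulrA
  transl_avg// transl_avg_comm.
Qed.

(** Rows [i] and [l] of [avg H] agree when [l - i] is in [H], and each row sums to 1. *)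
Lemma avg_idem : avg H * avg H = avg H.
Proof.
apply/matrixP => i j; rewrite mxE.
transitivity (\sum_l avg H i l * avg H i j); last first.
  by rewrite -mulr_suml avg_sum mul1r.
apply: eq_bigr => l _; rewrite [avg H i l]mxE; case: ifP => [li|]; rewrite ?mul0r//.
congr (_ * _); have /matrixP/(_ i j) := transl_avg li.
by rewrite transl_mulE addrC subrK.
Qed.

Lemma transl_avg_sum x i : \sum_j (transl x * avg H) i j = 1.
Proof. by under eq_bigr do rewrite transl_mulE; rewrite avg_sum. Qed.

Lemma expr_avg (X : 'M[R]_n.+1) x k : X * avg H = transl x * avg H ->
  X ^+ k * avg H = transl (x *+ k) * avg H.
Proof.
move=> Xx; elim: k => [|k IHk]; first by rewrite expr0 mulr0n transl0.
rewrite exprS -mulrA IHk transl_avg_comm mulrA Xx -mulrA -transl_avg_comm.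
by rewrite mulrA -translD mulrS.
Qed.

Variables (a : nat -> R) (r : nat).
Hypothesis sa : subprob a.
Hypothesis suma : series a @ \oo --> (1 : R).
Hypothesis supp_a : forall k, a k != 0 -> inZp k - inZp r \in H.

(** Every exponent [k] of [p] differs from [r] by an element of [H], so [X^k] and [X^r] agree after
    averaging, and the weights have total mass 1. *)
Lemma gfun_avg (X : 'M[R]_n.+1) x : substoch X ->
  X * avg H = transl x * avg H -> gfun a X * avg H = transl (x *+ r) * avg H.
Proof.
move=> sX Xx; apply/matrixP => i j.
have <- : limn (series (fun k => a k * (X ^+ k * avg H) i j)) = (gfun a X * avg H) i j.
  by apply: cvg_lim => //; exact: gfun_mulr_cvg.
have -> : series (fun k => a k * (X ^+ k * avg H) i j) =
    fun N => series a N * (transl (x *+ r) * avg H) i j.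
  apply/funext => N; rewrite /series /= mulr_suml; apply: eq_bigr => k _.
  have [->|/supp_a ak] := eqVneq (a k) 0; first by rewrite !mul0r.
  rewrite (expr_avg _ Xx) (@transl_avg_eq _ (x *+ r))//.
  have := zgroupMn x ak; rewrite mulrnBl -!inZp_mul ![(x * _)%N]mulnC !inZp_mul.
  by rewrite valZpK.
apply: cvg_lim => //; rewrite -[X in _ --> X]mul1r.
exact: cvgMr_tmp.
Qed.

End Average.
End Translations.

(** * Doeblin condition for [p(T)] and the two components of the iterates *)

Section Mixing.
Set Implicit Arguments.
Unset Strict Implicit.
Context {R : realType} {n : nat}.
Local Notation I := 'I_n.+1.
Implicit Types (x y i j : I) (H : {set I}).

Variables (H : {set I}) (a : nat -> R) (r : nat).
Hypotheses (gH : zgroup H) (sa : subprob a) (suma : series a @ \oo --> (1 : R)).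
Hypothesis ar : a r != 0.
Hypothesis supp_a : forall k, a k != 0 -> inZp k - inZp r \in H.
Hypothesis gen_H : forall S : I -> Prop, S 0 ->
  (forall x y, S x -> S y -> S (x + y)) ->
  (forall q, a (r + q)%N != 0 -> S (inZp q)) ->
  forall x, x \in H -> S x.

Let T : 'M[R]_n.+1 := transl (inZp 1).
Let X : 'M[R]_n.+1 := gfun a T.
Let sT : substoch T := substoch_transl _.
Let sX : substoch X := gfun_substoch sa sT.

Let X_avg : X * avg H = transl (inZp r) * avg H.
Proof. by rewrite /X (gfun_avg gH sa suma supp_a (x := inZp 1))// inZp_mulrn. Qed.

Let X_avg_comm : X * avg H = avg H * X.
Proof. by apply/esym/(gfun_comm sa sT); rewrite /GRing.comm -transl_avg_comm. Qed.

(** The drift [r] of each step is split off, so that the remaining displacement is a sum of elements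
    of [Q]. *)
Let reach N x := forall i, 0 < (X ^+ N) i (i + (inZp r *+ N + x)).

Let reach_add N M x y : reach N x -> reach M y -> reach (N + M) (x + y).
Proof.
move=> Nx My i; rewrite exprD mxE.
apply: lt_le_trans (mulr_gt0 (Nx i) (My (i + (inZp r *+ N + x)))) _.
have -> : i + (inZp r *+ N + x) + (inZp r *+ M + y)
    = i + (inZp r *+ (N + M) + (x + y)).
  by rewrite mulrnDr -!addrA; congr (_ + (_ + _)); rewrite addrCA.
rewrite (bigD1 (i + (inZp r *+ N + x)))//= lerDl sumr_ge0// => l _.
by rewrite mulr_ge0//; [have [] := substochX N sX|have [] := substochX M sX].
Qed.

Let reach1 q : a (r + q)%N != 0 -> reach 1 (inZp q).
Proof.
move=> arq i; rewrite expr1 mulr1n -inZpD.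
have b0 k : 0 <= a k * (T ^+ k) i (i + inZp (r + q)).
  by rewrite mulr_ge0//; [exact: sa.1|have [] := substochX k sT].
have := nneg_series_le b0 (gfun_cvg sa sT) (r + q).+1.
apply: lt_le_trans; rewrite /series /= big_nat_recr//=.
rewrite ltr_wpDl ?sumr_ge0// translZX mxE eqxx mulr1 lt_def arq.
exact: sa.1.
Qed.

Let reach_all : exists N, (0 < N)%N /\ forall x, x \in H -> reach N x.
Proof.
(* As [a r != 0], a step with [q = 0] spends time without changing [x]. *)
have reach_one N M x : reach N x -> reach (N + M) x.
  move=> Nx; elim: M => [|M IHM]; first by rewrite addn0.
  rewrite addnS -addn1 -[x]addr0; apply: reach_add => //.
  have -> : (0 : I) = inZp 0 by apply: val_inj; rewrite /= mod0n.
  by apply: reach1; rewrite addn0.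
have ex x : x \in H -> exists N, reach N x.
  apply: (gen_H (S := fun x => exists N, reach N x)).
  - by exists 0%N => i; rewrite expr0 mulr0n !addr0 mxE eqxx.
  - by move=> y z [N Ny] [M Mz]; exists (N + M)%N; exact: reach_add.
  - by move=> q arq; exists 1%N; exact: reach1.
have /choice[F FH] x : exists N, x \in H -> reach N x.
  by have [/ex[N Nx]|_] := boolP (x \in H); [exists N|exists 0%N].
(* The sum of all the waiting times serves every [x]; the successor makes it positive. *)
exists (\sum_x F x).+1; split=> // x Hx.
by rewrite (bigD1 x)//= -addnS; apply/reach_one/FH.
Qed.

(** Row [i] of [X^N avg H] is uniform on the coset [i + N r + H], on all of which row [i] of [X^N]
    is positive. *)
Lemma gfun_transl_doeblin : exists N eps, [/\ (0 < N)%N, 0 < eps < 1 &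
  forall i j, eps * (X ^+ N * avg H) i j <= (X ^+ N) i j].
Proof.
have [N [N0 reachN]] := reach_all; have sXN := substochX N sX.
(* The entries of [X ^+ N] are at most [1], so the product of the positive ones
   is a lower bound for each of them. *)
pose A := X ^+ N; pose f (p : I * I) := if A p.1 p.2 == 0 then 1 else A p.1 p.2.
have f0 p : 0 < f p.
  by rewrite /f; case: eqVneq => // Ap; rewrite lt_def Ap sXN.1.
have f1 p : f p <= 1 by rewrite /f; case: eqVneq => // Ap; exact: substoch_le1.
have F0 : 0 < \prod_p f p by apply: prodr_gt0.
have F1 : \prod_p f p <= 1 by apply: prodr_ile1 => p _; rewrite f1 ltW.
(* The factor 1/2 keeps [eps] below 1 even when the product is 1. *)
exists N, (2^-1 * \prod_p f p); split=> //; first by apply/andP; split; lra.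
move=> i j; rewrite (expr_avg _ X_avg) transl_mulE.
rewrite mxE; case: ifP => [Hj|_]; last by rewrite mulr0 sXN.1.
have Aij : 0 < A i j.
  have := reachN _ Hj i; congr (0 < A i _).
  by rewrite addrA addrC subrK.
have fA : \prod_p f p <= A i j.
  have fij : f (i, j) = A i j by rewrite /f /= gt_eqF.
  rewrite (bigD1 (i, j))//= fij ler_piMr ?(ltW Aij)//.
  by apply: prodr_ile1 => p _; rewrite f1 ltW.
have c1 : #|H|%:R^-1 <= 1 :> R.
  by rewrite invf_le1 ?card_zgroup_gt0// ler1n -(ltr0n R) card_zgroup_gt0.
apply: le_trans fA; apply: (@le_trans _ _ (2^-1 * \prod_p f p)).
  by rewrite ler_piMr//; lra.
by lra.
Qed.

(** Each application of [p] multiplies the translation by [r]; the exponent is [k.+1] because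
    [iterc a k] is [p^[k+1]]. *)
Lemma gfun_iterc_avg k :
  gfun (iterc a k) T * avg H = transl (inZp (r ^ k.+1)) * avg H.
Proof.
rewrite gfun_iterc//.
have : substoch (iter k.+1 (gfun a) T) /\
    iter k.+1 (gfun a) T * avg H = transl (inZp (r ^ k.+1)) * avg H.
  elim: k.+1 => [|l [sl IHl]] /=; first by rewrite expn0.
  split; first exact: gfun_substoch.
  by rewrite (gfun_avg gH sa suma supp_a sl IHl) expnS inZp_mul.
by case.
Qed.

Lemma gfun_iterc_complement i j : a 1%N < 1 ->
  (fun k => (gfun (iterc a k) T * (1 - avg H)) i j) @ \oo -->
    alim a * (1 - avg H) i j.
Proof.
move=> a1; have [N [eps [N0 e01 doeb]]] := gfun_transl_doeblin.
have sumXN l : \sum_j (X ^+ N * avg H) l j = 1.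
  by rewrite (expr_avg _ X_avg) transl_avg_sum.
have [K [s [s0 s1 XK]]] := doeblin_decay sX (substoch_avg gH) (avg_idem gH)
  X_avg_comm sumXN N0 e01 doeb.
have hs : 0 <= s <= 1 by rewrite s0 ltW.
(* The shift makes [p^[k+2](T)] equal to [p^[k+1]] at [X = p(T)], whose powers decay on
   [1 - avg H]. *)
rewrite -cvg_shiftS.
set u := (fun k => _); set v := fun k => iterc a k 0%N * (1 - avg H) i j.
have vl : v @ \oo --> alim a * (1 - avg H) i j.
  by apply: cvgMr_tmp; exact: alim_cvg.
have uv : (fun k => u k - v k) @ \oo --> (0 : R).
  have gap : (fun k => K * (pgf (iterc a k) s - iterc a k 0%N)) @ \oo --> (0 : R).
    by rewrite -[X in _ --> X](mulr0 K); apply: cvgMl_tmp; exact: iter_pgf_gap.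
  apply/norm_cvg0P; apply: (squeeze_cvgr _ (cvg_cst (0 : R)) gap).
  apply: nearW => k; rewrite normr_ge0 /u /v gfun_itercSr//=.
  by apply: gfun_decay => //; exact: subprob_iterc.
have -> : u = fun k => (u k - v k) + v k by apply/funext => k; rewrite subrK.
by rewrite -[alim a * _]add0r; exact: cvgD.
Qed.

End Mixing.

(** * The group algebra *)

Section CyclicGroup.
Set Implicit Arguments.
Unset Strict Implicit.
Context {R : realType} {n : nat}.
Local Notation I := 'I_n.+1.
Implicit Types (x y i j : I).

Lemma cvg_mx_coord p q (F : nat -> 'M[R]_(p, q)) (L : 'M[R]_(p, q)) :
  (forall k l, (fun N => F N k l) @ \oo --> L k l) -> F @ \oo --> L.
Proof.
move=> FL A [P PL PA].
have : \forall N \near \oo, forall k l, P k l (F N k l).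
  by apply: filter_forall => k; apply: filter_forall => l; exact: FL.
by apply: filterS => N PN; exact: PA.
Qed.

Lemma coord_cvg p q (F : nat -> 'M[R]_(p, q)) (L : 'M[R]_(p, q)) k l :
  F @ \oo --> L -> (fun N => F N k l) @ \oo --> L k l.
Proof.
move=> FL; pose f (M : 'M[R]_(p, q)) := M k l.
exact: (cvg_comp F f FL (@coord_continuous R p q k l L)).
Qed.

Lemma cvgn_subseq (u : nat -> R) (l c : R) (phi : nat -> nat) :
  u @ \oo --> l -> (forall k, (k <= phi k)%N) -> (forall k, u (phi k) = c) -> l = c.
Proof.
move=> ul phi_ge uc.
have phioo : phi @ \oo --> \oo.
  by move=> A [N _ NA]; exists N => // k /= Nk; apply: NA => /=; exact: leq_trans (phi_ge k).
have : (fun k => u (phi k)) @ \oo --> l by exact: (cvg_comp phi _ phioo ul).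
have -> : (fun k => u (phi k)) = cst c by apply/funext => k; exact: uc.
by move=> cl; apply: (cvg_unique _ cl (cvg_cst c)).
Qed.

(** Row 0 of [T^k] is the basis vector at [k] modulo the order, so row 0 of [f(T)] collects
    coefficients by residue. *)
Lemma evalC_gfun (f : nat -> R) j :
  evalC n.+1 f 0 j = gfun f (transl (inZp 1)) 0 j.
Proof.
rewrite !mxE; congr (limn _); apply/funext => N; apply: eq_bigr => k _.
rewrite translZX mxE add0r -val_eqE /= eq_sym.
by case: eqP; rewrite ?mulr1 ?mulr0.
Qed.

Variables (a : nat -> R) (r : nat).
Let G := Gp0 n.+1 a r.
Let H : {set I} := [set i : I | `[< G i >]]%SET.

Lemma Gp0_mem (k : nat) : G (k %% n.+1)%N <-> inZp k \in H.
Proof. by rewrite inE /=; split => [?|/asboolP//]; exact/asboolP. Qed.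

Lemma Gp0_zgroup : zgroup H.
Proof.
split=> [|x y].
  by rewrite inE; apply/asboolP; split=> // S [].
rewrite !finset.in_set => /asboolP[_ Sx] /asboolP[_ Sy]; apply/asboolP; split.
  exact: (ltn_ord (x - y)).
move=> S gS QS; have [_ _ SD SN] := gS; apply: SD; first exact: Sx.
by apply: SN; exact: Sy.
Qed.

Lemma Gp0_gen (q : nat) : a (r + q)%N != 0 -> inZp q \in H.
Proof.
move=> aq; apply/Gp0_mem; split; first by rewrite ltn_mod.
by move=> S _; apply.
Qed.

(** In a group of order [n.+1] the opposite of [k] is [n] copies of [k], so a submonoid is a
    subgroup. *)
Lemma Gp0_min (S : I -> Prop) : S 0 ->
  (forall x y, S x -> S y -> S (x + y)) ->
  (forall q, a (r + q)%N != 0 -> S (inZp q)) ->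
  forall x, x \in H -> S x.
Proof.
move=> S0 SD Sq x; rewrite inE => /asboolP[_ /(_ (fun k => (k < n.+1)%N /\ S (inZp k)))].
rewrite valZpK => Sx; apply: (proj2 (Sx _ _)) => {x Sx}; last first.
  by move=> q aq; rewrite ltn_mod; split=> //; have := Sq _ aq; rewrite -{1}[inZp q]valZpK.
split=> [k []//||k l [k_lt Sk] [l_lt Sl]|k [k_lt Sk]].
- by split=> //; rewrite -[inZp 0]/(inZp (val (0 : I))) valZpK.
- rewrite ltn_mod; split=> //.
  have -> : (inZp ((k + l) %% n.+1) : I) = inZp k + inZp l.
    by rewrite -inZpD; apply: val_inj; rewrite /= modn_mod.
  exact: SD.
- rewrite ltn_mod; split=> //.
  have -> : (inZp ((n.+1 - k) %% n.+1) : I) = inZp k *+ n.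
    have -> : (inZp k : I) *+ n = - inZp k.
      apply/eqP; rewrite -subr_eq0 opprK -mulrSr -inZp_mul.
      by apply/eqP/val_inj; rewrite /= modnMr.
    by apply: val_inj; rewrite /= modn_mod (modn_small k_lt).
  have SM l : S (inZp k *+ l) by elim: l => [|l IHl]; rewrite ?mulr0n// mulrS; exact: SD.
  exact: SM.
Qed.

Lemma cosetC_mem (c j : nat) :
  cosetC n.+1 c G j <-> (j < n.+1)%N /\ inZp j - inZp c \in H.
Proof.
split=> [[g [Gg ->]]|[jn jc]].
  rewrite ltn_mod; split=> //; have [gn _] := Gg.
  have -> : (inZp ((c + g) %% n.+1) : I) = inZp (c + g).
    by apply: val_inj; rewrite /= modn_mod.
  by rewrite inZpD addrC addKr; apply/Gp0_mem; rewrite modn_small.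
exists (val (inZp j - inZp c : I)); split; first by move: jc; rewrite inE => /asboolP.
have : inZp (c + val (inZp j - inZp c : I)) = inZp j :> I.
  by rewrite inZpD valZpK addrC subrK.
by move=> /(congr1 val) /= ->; rewrite modn_small.
Qed.

Lemma cC_avg j : cC R n.+1 G 0 j = avg H 0 j.
Proof.
by rewrite !mxE subr0 finset.in_set; case: ifP.
Qed.

Lemma gmul_tpow_cC (c : nat) j :
  gmul (tpow R n.+1 c) (cC R n.+1 G) 0 j = (transl (inZp c) * avg H) 0 j.
Proof.
have addE (i l : I) : ((i + l) %% n.+1 == j)%N = (l == j - i).
  by rewrite -[LHS]/(i + l == j) addrC eq_sym -subr_eq eq_sym.
have [x xE] : exists x : I, inZp c = x by exists (inZp c).
have tpowE i : tpow R n.+1 c 0 i = (x == i)%:R by rewrite mxE -xE.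
rewrite xE mxE (bigD1 x)//= [X in _ + X]big1 ?addr0; last first.
  move=> i /negPf ix; apply: big1 => l _.
  by rewrite tpowE [x == i]eq_sym ix mulr0 mul0r.
have [y yE] : exists y : I, j - x = y by exists (j - x).
rewrite (bigD1 y)//= big1 ?addr0; last first.
  by move=> l /negPf lj; rewrite addE yE lj !mul0r.
rewrite addE tpowE yE !eqxx !mul1r cC_avg transl_mulE !mxE add0r.
by rewrite subr0 yE.
Qed.

End CyclicGroup.

Theorem theorem4 (R : realType) (a : nat -> R) (r m d : nat) (mi : nat -> nat)
  (ha : forall i, 0 <= a i < 1)
  (hsum : (fun N => \sum_(0 <= i < N) a i) @ \oo --> (1 : R))
  (hr : a r != 0) (hr0 : forall i, (i < r)%N -> a i = 0)
  (htwo : exists i j, i != j /\ a (r + i)%N != 0 /\ a (r + j)%N != 0)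
  (hm : (0 < m)%N) (hd : (0 < d)%N)
  (hmi : forall i, (i < d)%N -> (mi i < m)%N)
  (hdist : forall i j, (i < d)%N -> (j < d)%N -> mi i = mi j -> i = j)
  (hper : exists K, forall k i, (K <= k)%N -> (i < d)%N ->
            r ^ (k * d + i) = mi i %[mod m]) :
  let G := Gp0 m a r in
  let u := fun n => evalC m (iterc a n) in
  ((~ exists j, forall i, (i < d)%N -> cosetC m (mi i) G j) ->
     ~ exists L : 'rV[R]_m, u @ \oo --> L)
  /\
  ((exists j, forall i, (i < d)%N -> cosetC m (mi i) G j) ->
     (forall i j, (i < d)%N -> (j < d)%N ->
        forall x, cosetC m (mi i) G x <-> cosetC m (mi j) G x)
     /\ u @ \oo --> gmul (tpow R m (mi 0%N)) (cC R m G)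
                     + alim a *: (eC R m - cC R m G)).
Proof.
case: m hm hmi hper => // n _ hmi [K hper] G u.
pose H := [set i : 'I_n.+1 | `[< G i >]]%SET.
have gH : zgroup H := Gp0_zgroup a r.
have a0 k : 0 <= a k by have /andP[] := ha k.
have suma : series a @ \oo --> (1 : R) by exact: hsum.
have sa : subprob a by split=> //; exact: nneg_series_le.
have supp_a k : a k != 0 -> inZp k - inZp r \in H.
  have [/hr0 ->|rk] := ltnP k r; first by rewrite eqxx.
  rewrite -{1 2}(subnKC rk) inZpD => ak.
  by rewrite addrC addKr; exact: Gp0_gen.
pose V k := gfun (iterc a k) (transl (inZp 1) : 'M[R]_n.+1).
have uV k j : u k 0 j = V k 0 j by exact: evalC_gfun.
have V_avg k j : (V k * avg H) 0 j = avg H (inZp (r ^ k.+1)) j.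
  by rewrite (gfun_iterc_avg gH sa suma supp_a) transl_mulE add0r.
have inZp_per k i : (K <= k)%N -> (i < d)%N ->
    inZp (r ^ (k * d + i)) = inZp (mi i) :> 'I_n.+1.
  by move=> Kk id; apply: val_inj; exact: hper.
split=> [nocap [L uL]|[j jcap]].
  (* By contraposition: a limit forces [tbar^{m_0}] into every coset. *)
  apply: nocap; exists (mi 0%N) => i id; apply/cosetC_mem; split; first exact: hmi.
  pose j : 'I_n.+1 := inZp (mi 0%N).
  have Vl : (fun k => (V k * avg H) 0 j) @ \oo --> \sum_l L 0 l * avg H l j.
    under eq_fun do rewrite mxE; apply: cvgn_sum => l; apply: cvgMr_tmp.
    by under eq_fun do rewrite -uV; exact: coord_cvg.
  have lim_at i' : (i' < d)%N -> \sum_l L 0 l * avg H l j = avg H (inZp (mi i')) j.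
    (* Predecessor, because [V k] involves [r ^ k.+1]; the offset [K.+1] reaches the periodic
       regime, where this subsequence is constant. *)
    move=> i'd; apply: (cvgn_subseq Vl (phi := fun k => ((k + K.+1) * d + i').-1)).
      move=> k; rewrite -ltnS prednK ?addn_gt0 ?muln_gt0 ?hd ?addnS//.
      apply: leq_trans (leq_addr _ _); apply: leq_trans (leq_pmulr _ hd).
      by rewrite ltnS leq_addr.
    move=> k; rewrite V_avg prednK ?addn_gt0 ?muln_gt0 ?hd ?addnS//.
    by rewrite inZp_per// -addnS (leq_trans (leqnSn K)) ?leq_addl.
  (* For the index 0 the limit is [1 / |H|], which is nonzero; for [i] it would vanish if
     [m_0 - m_i] were outside [H]. *)
  have := lim_at _ id; rewrite (lim_at 0%N)// !mxE subrr gH.1.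
  case: ifP => // _ /eqP; rewrite invr_eq0.
  by rewrite gt_eqF// card_zgroup_gt0.
have mi_mi i i' : (i < d)%N -> (i' < d)%N -> inZp (mi i) - inZp (mi i') \in H.
  move=> /jcap/cosetC_mem[_ ji] /jcap/cosetC_mem[_ ji'].
  by have := gH.2 _ _ ji' ji; rewrite opprB addrC addrA subrK.
split=> [i i' id i'd x|].
  split=> /cosetC_mem[xn xi]; apply/cosetC_mem; split=> //.
    by have := zgroupD gH xi (mi_mi _ _ id i'd); rewrite addrA subrK.
  by have := zgroupD gH xi (mi_mi _ _ i'd id); rewrite addrA subrK.
apply: cvg_mx_coord => k j'; rewrite ord1 {k}.
under eq_fun do rewrite uV.
rewrite mxE gmul_tpow_cC transl_mulE add0r.
(* Split along [1 = C + (1 - C)]: the first part is eventually constant, the second tends to its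
   multiple by [a]. *)
have -> : (fun k => V k 0 j') = fun k => (V k * avg H) 0 j' + (V k * (1 - avg H)) 0 j'.
  apply/funext => k; transitivity ((V k * avg H + V k * (1 - avg H)) 0 j').
    by rewrite mulrBr mulr1 addrC subrK.
  by rewrite mxE.
apply: cvgD.
  (* Beyond this bound the quotient of [k.+1] by [d] is at least [K], and all residues give the same
     coset. *)
  apply: cvg_near_cst; exists (K.+1 * d)%N => // k /= Kk; rewrite V_avg.
  rewrite (divn_eq k.+1 d) inZp_per ?ltn_mod//; last first.
    by rewrite leq_divRL// (leq_trans _ (leqW Kk))// leq_mul2r leqnSn orbT.
  have /matrixP/(_ 0 j') := transl_avg_eq (R := R) gH (mi_mi _ _ (ltn_pmod k.+1 hd) hd).
  by rewrite !transl_mulE !add0r.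
have -> : (alim a *: (eC R n.+1 - cC R n.+1 G)) 0 j' = alim a * (1 - avg H) 0 j'.
  have eCE : eC R n.+1 0 j' = (1 : 'M[R]_n.+1) 0 j'.
    by rewrite /eC !mxE mod0n -val_eqE.
  rewrite mxE; congr (_ * _); rewrite [LHS]mxE [RHS]mxE; congr (_ + _) => //.
  by rewrite [LHS]mxE [RHS]mxE cC_avg.
apply: (gfun_iterc_complement gH sa suma hr supp_a).
  exact: Gp0_min.
by have /andP[] := ha 1%N.
Qed.
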